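(* Let $\Gamma$ be a semigroup acting minimally by homeomorphisms of a compact metric space $X$, and let $A:\Gamma\times X\to\mathrm{GL}(n,\mathbb{R})$ be a continuous map satisfying $A(fg,x)=A(f,g(x))A(g,x)$ for all $x\in X$ and $f,g\in\Gamma$. Let $K_A(f,x):=\|A(f,x)^{-1}\|\cdot\|A(f,x)\|$. If there exist a point $x_0\in X$ and a constant $C>0$ such that $K_A(f,x_0)\le C$ for all $f\in\Gamma$, then there is a continuous invariant conformal structure on the bundle $X\times\mathbb{R}^n$. More precisely, $A$ is cohomologous to a cocycle taking values in the subgroup of conformal linear maps: there is a continuous map $B:X\to\mathrm{GL}(n,\mathbb{R})$ such that $B(f(x))^{-1}A(f,x)B(x)$ is a conformal linear map for all $f\in\Gamma$ and $x\in X$.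
   Context: The action is minimal if every orbit $\{f(x):f\in\Gamma\}$, $x\in X$, is dense in $X$. Continuity of $A$ means that $A(f,\cdot)$ is continuous for each $f\in\Gamma$. A linear map of $\mathbb{R}^n$ is conformal if it is a positive scalar multiple of an element of $\mathrm{O}(n,\mathbb{R})$. The space $\mathrm{Conf}(n)$ of conformal structures on $\mathbb{R}^n$ is identified with the space of positive-definite symmetric $n\times n$ real matrices of determinant $1$, on which $g\in \mathrm{GL}(n,\mathbb{R})$ acts by $g\cdot P:=(\det g^Tg)^{-1/n}\,gPg^T$. A continuous invariant conformal structure on $X\times\mathbb{R}^n$ is a continuous map $\varphi:X\to \mathrm{Conf}(n)$ with $\varphi(f(x))=A(f,x)\cdot\varphi(x)$ for all $f\in\Gamma$, $x\in X$. *)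

(* Defs.v *)
From HB Require Import structures.
From mathcomp Require Import all_boot all_order all_algebra.
From mathcomp Require Import all_classical all_reals all_analysis.

Set Implicit Arguments.
Unset Strict Implicit.
Unset Printing Implicit Defensive.

Import Order.TTheory GRing.Theory Num.Theory.
Import numFieldNormedType.Exports.

Local Open Scope classical_set_scope.
Local Open Scope ring_scope.

Definition homeomorphism (X Y : topologicalType) (f : X -> Y) : Prop :=
  continuous f /\
  exists g : Y -> X, [/\ cancel f g, cancel g f & continuous g].

(* [G] need not have a unit, so the orbit of [x] need not contain [x]. *)
Definition minimal_action (G : Type) (X : topologicalType)
    (act : G -> X -> X) : Prop :=
  forall x : X, dense [set act f x | f in [set: G]].

Definition euclid_norm (R : realType) (n : nat) (v : 'cV[R]_n) : R :=
  Num.sqrt (\sum_(i < n) v i ord0 ^+ 2).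

(* The library norm on ['M[R]_n] is the largest absolute value of an entry;
   this is the operator norm for the Euclidean norm on column vectors. *)
Definition opnorm (R : realType) (n : nat) (M : 'M[R]_n) : R :=
  sup [set euclid_norm (M *m v) | v in [set v | euclid_norm v <= 1]].

Definition distortion (R : realType) (n : nat) (G X : Type)
    (A : G -> X -> 'M[R]_n) (f : G) (x : X) : R :=
  opnorm (invmx (A f x)) * opnorm (A f x).

Definition orthogonal_mx (R : realType) (n : nat) (U : 'M[R]_n) : Prop :=
  U^T *m U = 1%:M.

Definition conformal (R : realType) (n : nat) (M : 'M[R]_n) : Prop :=
  exists (c : R) (U : 'M[R]_n), [/\ 0 < c, orthogonal_mx U & M = c *: U].

Definition pos_def (R : realType) (n : nat) (P : 'M[R]_n) : Prop :=
  forall v : 'cV[R]_n, v != 0 -> 0 < (v^T *m P *m v) ord0 ord0.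

Definition Conf (R : realType) (n : nat) : set 'M[R]_n :=
  [set P | [/\ P^T = P, pos_def P & \det P = 1]].

Definition conf_act (R : realType) (n : nat) (g P : 'M[R]_n) : 'M[R]_n :=
  (\det (g^T *m g)) `^ (- (n%:R)^-1) *: (g *m P *m g^T).

(* [GL(n, R)] and [Conf] carry the topology induced by ['M[R]_n], so maps
   into them are continuous when they are continuous into ['M[R]_n]. *)
Definition continuous_invariant_conformal_structure (R : realType) (n : nat)
    (G : Type) (X : topologicalType) (act : G -> X -> X)
    (A : G -> X -> 'M[R]_n) (phi : X -> 'M[R]_n) : Prop :=
  [/\ continuous phi,
      forall x, Conf (phi x) &
      forall f x, phi (act f x) = conf_act (A f x) (phi x)].

(* Main.v *)
Require Import Defs.
From HB Require Import structures.
From mathcomp Require Import all_boot all_order all_algebra.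
From mathcomp Require Import all_classical all_reals all_analysis.
From mathcomp Require Import perm ring lra.

Set Implicit Arguments.
Unset Strict Implicit.
Unset Printing Implicit Defensive.

Import Order.TTheory GRing.Theory Num.Theory.
Import numFieldNormedType.Exports.

Local Open Scope classical_set_scope.
Local Open Scope ring_scope.

(* Let [Z] be the closure of the orbit of [(x0, 1)] under the skew action on
   [X * Conf n]. Bounded distortion at [x0] makes [Z] compact, and minimality
   makes every fibre [Z_x] nonempty; [A f x] maps [Z_x] into, perhaps not onto,
   the fibre over [act f x]. The function [J(P, Q) = tr (P Q^-1)] on [Conf n] is
   invariant under GL(n) and linear in [P]. The number
   [r x = min_P max_(Q in Z_x) J(P, Q)] increases along orbits and is upper
   semicontinuous, so it is constant by minimality. As [det ((P + P') / 2) > 1]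
   for distinct [P, P'] of determinant [1], the minimiser [phi x] is unique;
   since [r] is constant, the pullback of [phi (act f x)] is a minimiser at [x],
   so [phi] is invariant. The Cholesky factor of [phi] is the required [B]. *)

(** * Positive definite matrices *)

Section PosDef.
Variable R : realType.

(** Recursion on the Schur complement of the top left entry. The explicit formula lets the factor be
    shown to depend continuously on [P]. *)
Fixpoint cholesky (n : nat) : 'M[R]_n -> 'M[R]_n :=
  match n with
  | 0 => id
  | m.+1 => fun P : 'M[R]_(1 + m) =>
      let a := P ord0 ord0 in
      block_mx (Num.sqrt a)%:M 0 ((Num.sqrt a)^-1 *: dlsubmx P)
        (cholesky (drsubmx P - a^-1 *: (dlsubmx P *m (dlsubmx P)^T)))
  end.

Lemma sqr_cV_ge0 (n : nat) (v : 'cV[R]_n) : 0 <= (v^T *m v) ord0 ord0.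
Proof. by rewrite mxE; apply: sumr_ge0 => i _; rewrite mxE -expr2 sqr_ge0. Qed.

Lemma sqr_cV_eq0 (n : nat) (v : 'cV[R]_n) :
  ((v^T *m v) ord0 ord0 == 0) = (v == 0).
Proof.
apply/idP/eqP => [|->]; last by rewrite mulmx0 mxE.
rewrite mxE psumr_eq0 => [/allP v0|i _]; last by rewrite mxE -expr2 sqr_ge0.
apply/colP => i; rewrite [RHS]mxE; apply/eqP.
by have := v0 i (mem_index_enum _); rewrite /= mxE -expr2 sqrf_eq0.
Qed.

Lemma Conf1 (n : nat) : Conf (1%:M : 'M[R]_n).
Proof.
split; [exact: trmx1| |exact: det1] => v v0.
by rewrite mulmx1 lt_def sqr_cV_eq0 v0 sqr_cV_ge0.
Qed.

Lemma pos_def_diag (n : nat) (P : 'M[R]_n) (i : 'I_n) :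
  pos_def P -> 0 < P i i.
Proof.
move=> /(_ (delta_mx i ord0)).
rewrite trmx_delta -rowE -colE !mxE; apply.
apply/eqP => /matrixP /(_ i ord0); rewrite !mxE !eqxx => /eqP.
by rewrite oner_eq0.
Qed.

Lemma pos_def_congr (n : nat) (g P : 'M[R]_n) :
  g \in unitmx -> pos_def P -> pos_def (g *m P *m g^T).
Proof.
move=> gU Pp v v0; have := Pp (g^T *m v).
rewrite trmx_mul trmxK !mulmxA; apply.
apply: contra_neq v0 => gv0.
by rewrite -(mulKmx (_ : g^T \in unitmx) v) ?unitmx_tr// gv0 mulmx0.
Qed.

Lemma sym_mx_block (m : nat) (P : 'M[R]_(1 + m)) : P^T = P ->
  P = block_mx (P ord0 ord0)%:M (dlsubmx P)^T (dlsubmx P) (drsubmx P).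
Proof.
move=> Psym; rewrite -[LHS]submxK; congr block_mx.
  rewrite [LHS]mx11_scalar; congr (_%:M); rewrite !mxE.
  by congr (P _ _); apply/val_inj.
by rewrite trmx_dlsub Psym.
Qed.

(** With [a] the corner entry and [b] the column below it, the first coordinate [- a^-1 b^T w]
    minimises the form of [P] for given [w]; the minimum is the form of the Schur complement at
    [w]. *)
Lemma pos_def_schur (m : nat) (P : 'M[R]_(1 + m)) : P^T = P -> pos_def P ->
  pos_def (drsubmx P - (P ord0 ord0)^-1 *: (dlsubmx P *m (dlsubmx P)^T)).
Proof.
move=> Psym Pp w w0.
have a0 : P ord0 ord0 != 0 by rewrite gt_eqF// pos_def_diag.
set a : R := P ord0 ord0 in a0 *; set b := dlsubmx P; set D := drsubmx P.
have E := sym_mx_block Psym; rewrite -/a -/b -/D in E.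
have := Pp (col_mx (- a^-1 *: (b^T *m w)) w).
rewrite [X in _ *m X *m _]E tr_col_mx.
have -> : (- a^-1 *: (b^T *m w))^T = - a^-1 *: (w^T *m b).
  by rewrite linearZ/= trmx_mul trmxK.
rewrite mul_row_block mul_row_col.
have -> : - a^-1 *: (w^T *m b) *m a%:M = - (w^T *m b).
  by rewrite mul_mx_scalar scalerA mulrN mulfV// scaleN1r.
have -> : w^T *m (D - a^-1 *: (b *m b^T)) =
          - a^-1 *: (w^T *m b) *m b^T + w^T *m D.
  by rewrite mulmxBr -scalemxAr mulmxA scaleNr mulNmx -scalemxAl addrC.
rewrite addNr mul0mx add0r; apply.
by apply: contra_neq w0 => /eqP; rewrite col_mx_eq0 => /andP[_ /eqP].
Qed.

Lemma cholesky_spec (n : nat) (P : 'M[R]_n) : P^T = P -> pos_def P ->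
  [/\ cholesky P *m (cholesky P)^T = P, is_trig_mx (cholesky P) &
      forall i, 0 < cholesky P i i].
Proof.
elim: n P => [|m IH] P Psym Pp.
  by split; [apply/matrixP => -[] | apply/is_trig_mxP => -[] | case].
have a_gt0 : 0 < P ord0 ord0 := pos_def_diag ord0 Pp.
have [|LL Ltrig Ldiag] := IH _ _ (pos_def_schur Psym Pp).
  rewrite linearB linearZ/= trmx_mul trmxK; congr (_ - _).
  by rewrite trmx_drsub Psym.
rewrite /=; set a : R := P ord0 ord0 in a_gt0 LL Ltrig Ldiag *.
have sa : Num.sqrt a * Num.sqrt a = a by rewrite -expr2 sqr_sqrtr// ltW.
have sa0 : 0 < Num.sqrt a by rewrite sqrtr_gt0.
set L := cholesky _ in LL Ltrig Ldiag *.
split.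
- rewrite (@tr_block_mx _ 1 m 1 m) (@mulmx_block _ 1 m 1 m 1 m).
  rewrite !trmx0 !mul0mx !mulmx0 !addr0.
  rewrite !linearZ/= tr_scalar_mx -!scalemxAl !mul_scalar_mx.
  rewrite mul_mx_scalar !scalerA -invfM sa mulVf ?gt_eqF// !scale1r LL.
  rewrite scale_scalar_mx sa addrC subrK.
  exact: esym (sym_mx_block Psym).
- by rewrite (@is_trig_block_mx _ 1 m 1 m)// eqxx scalar_mx_is_trig Ltrig.
- move=> i; case: (split_ordP (i : 'I_(1 + m))) => j ->.
    by rewrite (@block_mxEul _ 1 m 1 m) !mxE ord1 eqxx mulr1n.
  by rewrite (@block_mxEdr _ 1 m 1 m).
Qed.

Lemma cholesky_unit (n : nat) (P : 'M[R]_n) : P^T = P -> pos_def P ->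
  cholesky P \in unitmx.
Proof.
move=> Ps Pp; have [_ Ltrig Ldiag] := cholesky_spec Ps Pp.
rewrite unitmxE (det_trig Ltrig) unitfE; apply/prodf_neq0 => i _.
by rewrite gt_eqF.
Qed.

Lemma det_pos_def (n : nat) (P : 'M[R]_n) : P^T = P -> pos_def P ->
  0 < \det P.
Proof.
move=> Ps Pp; have [LL Ltrig Ldiag] := cholesky_spec Ps Pp.
rewrite -LL det_mulmx det_tr (det_trig Ltrig).
by rewrite mulr_gt0// prodr_gt0.
Qed.

Lemma mxtrace_pos_def (n : nat) (P : 'M[R]_n) : pos_def P -> 0 <= \tr P.
Proof. by move=> Pp; apply: sumr_ge0 => i _; apply/ltW/pos_def_diag. Qed.

(** Writing [P = L L^T], the inequality [2 |x y| <= x^2 + y^2] bounds the entry by the mean of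
    [P i i] and [P j j]. *)
Lemma pos_def_entry_le (n : nat) (P : 'M[R]_n) (i j : 'I_n) :
  P^T = P -> pos_def P -> `|P i j| <= \tr P.
Proof.
move=> Ps Pp; move: (cholesky P) (cholesky_spec Ps Pp) => L [LL _ _].
have Pd k : P k k <= \tr P.
  rewrite /mxtrace (bigD1 k)//= lerDl; apply: sumr_ge0 => l _.
  exact/ltW/pos_def_diag.
have PE k l : P k l = \sum_h L k h * L l h.
  by rewrite -LL mxE; apply: eq_bigr => h _; rewrite mxE.
apply: (@le_trans _ _ ((P i i + P j j) / 2)); last first.
  by rewrite ler_pdivrMr// mulr_natr mulr2n lerD.
rewrite !PE -big_split/= mulr_suml (le_trans (ler_norm_sum _ _ _))//.
apply: ler_sum => h _; rewrite ler_pdivlMr// normrM -!expr2.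
rewrite -(real_normK (num_real (L i h))) -(real_normK (num_real (L j h))).
by have := sqr_ge0 (`|L i h| - `|L j h|); nra.
Qed.

(* AM-GM for the squared diagonal entries of the Cholesky factor: their
   product is the determinant and their sum is at most the trace. *)
Lemma det_le_trace (n : nat) (P : 'M[R]_n) : P^T = P -> pos_def P ->
  \det P <= (\tr P / n%:R) ^+ n ?= iff (P == (\tr P / n%:R)%:M).
Proof.
case: n P => [|n] P Ps Pp.
  rewrite det_mx00 expr0; split; first by [].
  by rewrite eqxx; apply/esym/eqP/matrixP => -[].
move: (cholesky P) (cholesky_spec Ps Pp) => L [LL Ltrig Ldiag].
have n0 : (0 : R) < n.+1%:R by rewrite ltr0n.
have trE : \tr P = \sum_i L i i ^+ 2 + \sum_i \sum_(j | j != i) L i j ^+ 2.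
  rewrite -{1}LL /mxtrace -big_split/=; apply: eq_bigr => i _.
  rewrite mxE (bigD1 i)//= mxE expr2; congr (_ + _).
  by apply: eq_bigr => j _; rewrite mxE expr2.
have r0 : 0 <= \sum_i \sum_(j | j != i) L i j ^+ 2.
  by do 2![apply: sumr_ge0 => ? _]; exact: sqr_ge0.
have d0 : 0 <= \sum_i L i i ^+ 2 by apply: sumr_ge0 => i _; exact: sqr_ge0.
have detE : \det P = \prod_(i < n.+1) L i i ^+ 2.
  rewrite -{1}LL det_mulmx det_tr (det_trig Ltrig) -big_split/=.
  by apply: eq_bigr => i _; rewrite expr2.
have [AG AGeq] := @leif_AGM _ 'I_n.+1 predT (fun i => L i i ^+ 2)
  (fun i _ => sqr_ge0 _).
rewrite -detE cardT/= size_enum_ord in AG AGeq.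
have ST : ((\sum_i L i i ^+ 2) / n.+1%:R) ^+ n.+1 <= (\tr P / n.+1%:R) ^+ n.+1.
  apply: lerXn2r; rewrite ?nnegrE ?(divr_ge0 _ (ltW n0)) ?mxtrace_pos_def//.
  by rewrite ler_pM2r ?invr_gt0// trE lerDl.
split; first exact: le_trans AG ST.
apply/idP/idP => [/eqP E|/eqP ->]; last first.
  by rewrite mxtrace_scalar det_scalar -(mulr_natr (_ / _)) mulfK// (gt_eqF n0).
(* Equality overall forces equality in both estimates: the trace has no off-diagonal contribution,
   so [L] is diagonal, and AM-GM makes its squared diagonal entries equal. *)
have ST' : (\sum_i L i i ^+ 2) / n.+1%:R = \tr P / n.+1%:R.
  apply/eqP; rewrite -(@eqrXn2 _ n.+1) ?(divr_ge0 _ (ltW n0)) ?mxtrace_pos_def//.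
  by apply/eqP/le_anti; rewrite ST -E AG.
have {}AGeq : [forall i, forall j, L i i ^+ 2 == L j j ^+ 2].
  by rewrite -AGeq; apply/eqP; rewrite E -ST'.
have L0 i j : j != i -> L i j = 0.
  move=> ji; have /eqP : \sum_i \sum_(j | j != i) L i j ^+ 2 = 0.
    have n1 : (n.+1%:R : R)^-1 != 0 by rewrite invr_eq0 (gt_eqF n0).
    by apply: (addrI (\sum_i L i i ^+ 2)); rewrite addr0 -trE (mulIf n1 ST').
  rewrite psumr_eq0; last by move=> k _; apply: sumr_ge0 => l _; exact: sqr_ge0.
  move=> /allP /(_ i); rewrite mem_index_enum => /(_ isT)/=.
  rewrite psumr_eq0; last by move=> l _; exact: sqr_ge0.
  move=> /allP /(_ j); rewrite mem_index_enum ji => /(_ isT)/=.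
  by rewrite sqrf_eq0 => /eqP.
have PE : P = (L ord0 ord0 ^+ 2)%:M.
  apply/matrixP => i j; rewrite -{1}LL !mxE (bigD1 i)//= big1 ?addr0; last first.
    by move=> k ki; rewrite L0// mul0r.
  rewrite mxE; have [<-|ij] := eqVneq i j; last by rewrite [L j i]L0// mulr0 mulr0n.
  by rewrite mulr1n -expr2; apply/eqP; move/forallP/(_ i)/forallP/(_ ord0) : AGeq.
by rewrite PE mxtrace_scalar -(mulr_natr (_ ^+ 2)) mulfK// (gt_eqF n0).
Qed.

Lemma Conf_midpoint (n : nat) (P P' : 'M[R]_n) (M := 2^-1 *: (P + P')) :
  Conf P -> Conf P' -> M^T = M /\ pos_def M.
Proof.
move=> [Ps Pp _] [Qs Qp _]; split; first by rewrite linearZ linearD/= Ps Qs.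
move=> v v0; rewrite -scalemxAr -scalemxAl mulmxDr mulmxDl !mxE.
by rewrite mulr_gt0// addr_gt0//; [have := Pp v v0|have := Qp v v0]; rewrite !mxE.
Qed.

(* Apply the congruence that turns the midpoint into the identity: the traces
   of the images of [P] and [Q] then add up to [2n], while AM-GM bounds each of
   them below by [n] as soon as the midpoint has determinant at most [1]. *)
Lemma det_midpoint_gt1 (n : nat) (P Q : 'M[R]_n) : Conf P -> Conf Q ->
  P != Q -> 1 < \det (2^-1 *: (P + Q)).
Proof.
move=> PC QC; have [Ms Mp] := Conf_midpoint PC QC.
case: PC QC => [Ps Pp Pd] [Qs Qp Qd]; apply: contraNT; rewrite -leNgt => d1.
case: n P Q Ps Pp Pd Qs Qp Qd Ms Mp d1 => [|n] P Q Ps Pp Pd Qs Qp Qd Ms Mp d1.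
  by apply/eqP/matrixP => -[].
set M := _ *: _ in Ms Mp d1.
have := cholesky_unit Ms Mp; move: (cholesky M) (cholesky_spec Ms Mp).
move=> L [LL _ _] LU; set g := invmx L.
have gU : g \in unitmx by rewrite unitmx_inv.
have n0 : (0 : R) < n.+1%:R by rewrite ltr0n.
have Ls W : W^T = W -> (g *m W *m g^T)^T = g *m W *m g^T.
  by move=> Ws; rewrite !trmx_mul trmxK Ws mulmxA.
have gM : g *m M *m g^T = 1%:M.
  by rewrite -LL !mulmxA mulVmx// mul1mx -trmx_mul mulVmx// trmx1.
have gK W : L *m (g *m W *m g^T) *m L^T = W.
  by rewrite !mulmxA mulmxV// mul1mx -mulmxA -trmx_mul mulmxV// trmx1 mulmx1.
have g1 : 1 <= \det g ^+ 2.
  have := congr1 determinant gM; rewrite !det_mulmx det_tr det1 mulrAC -expr2.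
  have := det_pos_def Ms Mp; have := sqr_ge0 (\det g); nra.
have dW W : W^T = W -> pos_def W -> \det W = 1 ->
    1 <= \tr (g *m W *m g^T) / n.+1%:R /\
    (\tr (g *m W *m g^T) / n.+1%:R = 1 -> W = M).
  move=> Ws Wp Wd; have Wp' := pos_def_congr gU Wp.
  have [le_tr eq_tr] := det_le_trace (Ls _ Ws) Wp'.
  have dE : \det (g *m W *m g^T) = \det g ^+ 2.
    by rewrite !det_mulmx det_tr Wd mulr1 -expr2.
  split=> [|t1].
    rewrite -(@ler_pXn2r _ n.+1)// ?nnegrE ?ler01//.
      by rewrite expr1n (le_trans _ le_tr)// dE.
    by rewrite divr_ge0 ?ler0n//; exact: mxtrace_pos_def Wp'.
  rewrite t1 expr1n in le_tr eq_tr.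
  have /eqP W1 : g *m W *m g^T == 1%:M.
    by rewrite -eq_tr; apply/eqP/le_anti; rewrite le_tr dE.
  by rewrite -(gK W) W1 mulmx1.
have [tP eP] := dW P Ps Pp Pd; have [tQ eQ] := dW Q Qs Qp Qd.
have tPQ : \tr (g *m P *m g^T) / n.+1%:R + \tr (g *m Q *m g^T) / n.+1%:R = 2.
  have := congr1 mxtrace gM; rewrite /M -scalemxAr -scalemxAl mulmxDr mulmxDl.
  rewrite mxtraceZ mxtraceD mxtrace1 -mulrDl => /(canRL (mulKf _)) ->.
    by rewrite invrK mulfK// (gt_eqF n0).
  by rewrite invr_eq0 pnatr_eq0.
move: (_ / _) (\tr (g *m Q *m _) / _) eP tP eQ tQ tPQ => s t eP s1 eQ t1 st.
(* Both numbers are at least 1 and their sum is 2; the equality case then identifies [P] and [Q]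
   with the midpoint. *)
have [s_eq t_eq] : s = 1 /\ t = 1 by clear -s1 t1 st; split; lra.
by rewrite eP// eQ.
Qed.

(* On [Conf] the adjugate is the inverse; unlike [invmx] it is polynomial in the
   entries, hence continuous everywhere. *)
Definition conf_cost (n : nat) (P Q : 'M[R]_n) : R := \tr (P *m \adj Q).

Lemma Conf_unitmx (n : nat) (P : 'M[R]_n) : Conf P -> P \in unitmx.
Proof. by case=> _ _ Pd; rewrite unitmxE Pd unitr1. Qed.

Lemma conf_costE (n : nat) (P Q : 'M[R]_n) : Conf Q ->
  conf_cost P Q = \tr (P *m invmx Q).
Proof.
move=> QC; rewrite /conf_cost /invmx (Conf_unitmx QC).
by case: QC => _ _ ->; rewrite invr1 scale1r.
Qed.

Lemma invmx_mul_tr (n : nat) (L : 'M[R]_n) : L \in unitmx ->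
  invmx (L *m L^T) = (invmx L)^T *m invmx L.
Proof.
move=> LU; have LLU : L *m L^T \in unitmx by rewrite unitmx_mul unitmx_tr LU.
apply: (can_inj (mulKmx LLU)); rewrite mulmxV// mulmxA.
by rewrite -[L *m L^T *m _]mulmxA -trmx_mul mulVmx// trmx1 mulmx1 mulmxV.
Qed.

(** With [Q = L L^T], the cost is the trace of [L^-1 P (L^-1)^T], which is positive definite of
    determinant 1, so AM-GM applies. *)
Lemma conf_cost_ge (n : nat) (P Q : 'M[R]_n) : Conf P -> Conf Q ->
  n%:R <= conf_cost P Q.
Proof.
case: n P Q => [|n] P Q PC QC; first by rewrite /conf_cost /mxtrace big_ord0.
rewrite conf_costE//; case: PC QC => [Ps Pp Pd] [Qs Qp Qd].
have := cholesky_unit Qs Qp; move: (cholesky Q) (cholesky_spec Qs Qp).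
move=> L [LL _ _] LU; have gU : invmx L \in unitmx by rewrite unitmx_inv.
set W := invmx L *m P *m (invmx L)^T.
have -> : \tr (P *m invmx Q) = \tr W.
  rewrite /W [RHS]mxtrace_mulC mulmxA [RHS]mxtrace_mulC -LL invmx_mul_tr//.
have Wp : pos_def W := pos_def_congr gU Pp.
have Ws : W^T = W by rewrite /W !trmx_mul trmxK Ps mulmxA.
have [le_tr _] := det_le_trace Ws Wp.
have n0 : (0 : R) < n.+1%:R by rewrite ltr0n.
have Wd : \det W = 1.
  rewrite /W !det_mulmx det_tr Pd mulr1 det_inv -invfM.
  by rewrite -[X in _ * X]det_tr -det_mulmx LL Qd invr1.
rewrite Wd in le_tr; rewrite -[X in X <= _]mul1r -ler_pdivlMr//.
rewrite -(@ler_pXn2r _ n.+1)// ?nnegrE ?ler01 ?expr1n//.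
by rewrite divr_ge0 ?ler0n//; exact: mxtrace_pos_def Wp.
Qed.

(** Makes the cost proper in [P] while [Q] stays bounded. With [P = L W L^T] and [Q = L L^T], the
    trace of [P] is that of [W (L^T L)], a sum of [n^2] products of entries, each bounded by the
    product of the two traces. *)
Lemma conf_trace_le (n : nat) (P Q : 'M[R]_n) : Conf P -> Conf Q ->
  \tr P <= n%:R ^+ 2 * (conf_cost P Q * \tr Q).
Proof.
move=> PC QC; rewrite conf_costE//; case: PC QC => [Ps Pp Pd] [Qs Qp Qd].
have := cholesky_unit Qs Qp; move: (cholesky Q) (cholesky_spec Qs Qp).
move=> L [LL _ _] LU; have gU : invmx L \in unitmx by rewrite unitmx_inv.
set W := invmx L *m P *m (invmx L)^T.
have -> : \tr (P *m invmx Q) = \tr W.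
  rewrite /W [RHS]mxtrace_mulC mulmxA [RHS]mxtrace_mulC -LL invmx_mul_tr//.
have Wp : pos_def W := pos_def_congr gU Pp.
have Ws : W^T = W by rewrite /W !trmx_mul trmxK Ps mulmxA.
have LLp : pos_def (L^T *m L).
  rewrite -[L^T]mulmx1 -[X in _ *m X]trmxK; apply: pos_def_congr.
    by rewrite unitmx_tr.
  by have [] := @Conf1 n.
have LLs : (L^T *m L)^T = L^T *m L by rewrite trmx_mul trmxK.
have -> : P = L *m W *m L^T.
  by rewrite /W !mulmxA mulmxV// mul1mx -mulmxA -trmx_mul mulmxV// trmx1 mulmx1.
rewrite -mulmxA mxtrace_mulC -mulmxA.
have -> : \tr Q = \tr (L^T *m L) by rewrite -LL mxtrace_mulC.
apply: (@le_trans _ _ (\sum_(i < n) \sum_(j < n) (\tr W * \tr (L^T *m L)))).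
  apply: ler_sum => i _; rewrite mxE; apply: ler_sum => j _.
  rewrite (le_trans (ler_norm _))// normrM ler_pM// pos_def_entry_le//.
by rewrite !sumr_const !card_ord -mulrnA -[leLHS]mulr_natl natrM expr2.
Qed.

End PosDef.

(** * The conformal action *)

Section ConformalAction.
Variables (R : realType) (n : nat).
Implicit Types g h P Q : 'M[R]_n.

Definition conf_scale g : R := (\det (g^T *m g)) `^ (- (n%:R)^-1).

Lemma det_trmx_mul g : \det (g^T *m g) = \det g ^+ 2.
Proof. by rewrite det_mulmx det_tr expr2. Qed.

Lemma conf_scale_gt0 g : g \in unitmx -> 0 < conf_scale g.
Proof.
move=> gU; rewrite powR_gt0// det_trmx_mul lt0r sqr_ge0 andbT sqrf_eq0.
by rewrite -unitfE -unitmxE.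
Qed.

Lemma conf_scale_expn g : (0 < n)%N -> g \in unitmx ->
  conf_scale g ^+ n * \det g ^+ 2 = 1.
Proof.
move=> n0 gU; have g0 : \det g != 0 by rewrite -unitfE -unitmxE.
rewrite -powR_mulrn ?powR_ge0// /conf_scale -powRrM mulNr mulVf; last first.
  by rewrite pnatr_eq0 -lt0n.
by rewrite det_trmx_mul powR_inv1 ?sqr_ge0// mulVf// sqrf_eq0.
Qed.

Lemma conf_act_Conf g P : g \in unitmx -> Conf P -> Conf (conf_act g P).
Proof.
move=> gU [Ps Pp Pd]; rewrite /conf_act -/(conf_scale g); split.
- by rewrite linearZ/= !trmx_mul trmxK Ps mulmxA.
- move=> v v0; rewrite -scalemxAr -scalemxAl mxE mulr_gt0 ?conf_scale_gt0//.
  exact: pos_def_congr.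
- have [n0|n0] := posnP n.
    by move: (_ *: _); rewrite n0 => M; rewrite det_mx00.
  rewrite detZ !det_mulmx det_tr Pd mulr1 -expr2.
  exact: conf_scale_expn.
Qed.

Lemma conf_act1 P : conf_act 1%:M P = P.
Proof.
by rewrite /conf_act trmx1 !mulmx1 det1 powR1 scale1r mul1mx.
Qed.

Lemma conf_actM g h P : conf_act (g *m h) P = conf_act g (conf_act h P).
Proof.
rewrite /conf_act !det_trmx_mul det_mulmx exprMn powRM ?sqr_ge0//.
by rewrite -scalemxAr -scalemxAl scalerA trmx_mul !mulmxA.
Qed.

Lemma conf_actKV g P : g \in unitmx -> conf_act g (conf_act (invmx g) P) = P.
Proof. by move=> gU; rewrite -conf_actM mulmxV// conf_act1. Qed.

(** The scalar factors cancel in [P Q^-1], which the action merely conjugates by [g]. *)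
Lemma conf_cost_act g P Q : g \in unitmx -> Conf Q ->
  conf_cost (conf_act g P) (conf_act g Q) = conf_cost P Q.
Proof.
move=> gU QC; have QC' := conf_act_Conf gU QC.
have QU := Conf_unitmx QC; have QU' := Conf_unitmx QC'.
rewrite !conf_costE//.
have gTU : g^T \in unitmx by rewrite unitmx_tr.
have -> : conf_act g P *m invmx (conf_act g Q) =
    g *m (P *m invmx Q) *m invmx g.
  apply: (can_inj (mulmxK QU')); rewrite mulmxKV// /conf_act.
  rewrite -scalemxAr !mulmxA mulmxKV// -[RHS]/(_ *: _); congr (_ *: _).
  by rewrite mulmxKV.
by rewrite mxtrace_mulC mulKmx.
Qed.

Lemma conf_costD P P' Q : conf_cost (P + P') Q = conf_cost P Q + conf_cost P' Q.
Proof. by rewrite /conf_cost mulmxDl mxtraceD. Qed.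

Lemma conf_costZ (a : R) P Q : conf_cost (a *: P) Q = a * conf_cost P Q.
Proof. by rewrite /conf_cost -scalemxAl mxtraceZ. Qed.

End ConformalAction.

(** * Continuity and compactness for matrices *)

Section MatrixTopology.
Variable R : realType.

Lemma continuous_mxP (T : topologicalType) (m n : nat) (F : T -> 'M[R]_(m, n)) :
  (forall i j, continuous (fun x => F x i j)) -> continuous F.
Proof.
move=> Fc x; apply/cvg_mx_entourageP => A entA.
apply: (@filter_forall _ _ (fun i (N : 'M[R]_(m, n)) =>
  forall j, (F x i j, N i j) \in A) (F @ x)) => i.
apply: (@filter_forall _ _ (fun j (N : 'M[R]_(m, n)) =>
  (F x i j, N i j) \in A) (F @ x)) => j.
have /cvg_entourageP/(_ A entA) := Fc i j x.
by apply: (@filterS _ (nbhs x)) => y; rewrite /= inE.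
Qed.

Lemma continuous_entry (T : topologicalType) (m n : nat) (F : T -> 'M[R]_(m, n))
    (i : 'I_m) (j : 'I_n) : continuous F -> continuous (fun x => F x i j).
Proof.
move=> Fc x; apply: (@continuous_comp _ _ _ F (fun M : 'M[R]_(m, n) => M i j)).
  exact: Fc.
exact: coord_continuous.
Qed.

Lemma continuous_sum (T : topologicalType) (I : Type) (r : seq I) (p : pred I)
    (F : I -> T -> R) : (forall i, p i -> continuous (F i)) ->
  continuous (fun x => \sum_(i <- r | p i) F i x).
Proof. exact/continuous_big/add_continuous. Qed.

Lemma continuous_prod (T : topologicalType) (I : Type) (r : seq I) (p : pred I)
    (F : I -> T -> R) : (forall i, p i -> continuous (F i)) ->
  continuous (fun x => \prod_(i <- r | p i) F i x).
Proof. exact/continuous_big/mul_continuous. Qed.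

Lemma continuous_mul (T : topologicalType) (f g : T -> R) :
  continuous f -> continuous g -> continuous (fun x => f x * g x).
Proof. by move=> fc gc x; apply: cvgM; [exact: fc|exact: gc]. Qed.

Lemma continuous_trmx (T : topologicalType) (m n : nat) (F : T -> 'M[R]_(m, n)) :
  continuous F -> continuous (fun x => (F x)^T).
Proof.
move=> Fc; apply: continuous_mxP => i j; under eq_fun do rewrite mxE.
exact: continuous_entry.
Qed.

Lemma continuous_mulmx (T : topologicalType) (m n p : nat)
    (F : T -> 'M[R]_(m, n)) (G : T -> 'M[R]_(n, p)) :
  continuous F -> continuous G -> continuous (fun x => F x *m G x).
Proof.
move=> Fc Gc; apply: continuous_mxP => i j; under eq_fun do rewrite mxE.
by apply: continuous_sum => k _; apply: continuous_mul; exact: continuous_entry.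
Qed.

Lemma continuous_scalemx (T : topologicalType) (m n : nat)
    (f : T -> R) (F : T -> 'M[R]_(m, n)) :
  continuous f -> continuous F -> continuous (fun x => f x *: F x).
Proof.
move=> fc Fc; apply: continuous_mxP => i j; under eq_fun do rewrite mxE.
by apply: continuous_mul => //; exact: continuous_entry.
Qed.

Lemma continuous_addmx (T : topologicalType) (m n : nat)
    (F G : T -> 'M[R]_(m, n)) :
  continuous F -> continuous G -> continuous (fun x => F x + G x).
Proof. by move=> Fc Gc x; apply: cvgD; [exact: Fc|exact: Gc]. Qed.

Lemma continuous_mxtrace (T : topologicalType) (n : nat) (F : T -> 'M[R]_n) :
  continuous F -> continuous (fun x => \tr (F x)).
Proof. by move=> Fc; apply: continuous_sum => i _; exact: continuous_entry. Qed.

Lemma continuous_det (T : topologicalType) (n : nat) (F : T -> 'M[R]_n) :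
  continuous F -> continuous (fun x => \det (F x)).
Proof.
move=> Fc; apply: continuous_sum => s _; apply: continuous_mul.
  exact: cst_continuous.
by apply: continuous_prod => i _; exact: continuous_entry.
Qed.

Lemma continuous_adj (T : topologicalType) (n : nat) (F : T -> 'M[R]_n) :
  continuous F -> continuous (fun x => \adj (F x)).
Proof.
move=> Fc; apply: continuous_mxP => i j; under eq_fun do rewrite mxE.
apply: continuous_mul; first exact: cst_continuous.
apply: continuous_det; apply: continuous_mxP => k l.
by under eq_fun do rewrite !mxE; exact: continuous_entry.
Qed.

Lemma continuous_conf_cost (T : topologicalType) (n : nat) (F G : T -> 'M[R]_n) :
  continuous F -> continuous G -> continuous (fun x => conf_cost (F x) (G x)).
Proof.
move=> Fc Gc; apply: continuous_mxtrace; apply: continuous_mulmx => //.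
exact: continuous_adj.
Qed.

Lemma continuous_conf_act (T : topologicalType) (n : nat) (F G : T -> 'M[R]_n) :
  (forall x, F x \in unitmx) -> continuous F -> continuous G ->
  continuous (fun x => conf_act (F x) (G x)).
Proof.
move=> FU Fc Gc; apply: continuous_scalemx; last first.
  apply: continuous_mulmx; last exact: continuous_trmx.
  exact: continuous_mulmx.
have F0 x : 0 < \det ((F x)^T *m F x).
  rewrite det_trmx_mul lt0r sqr_ge0 andbT sqrf_eq0.
  by rewrite -unitfE -unitmxE.
(* [powR] is defined by cases on a zero base; a positive determinant leaves only the branch built
   from [expR] and [ln]. *)
under eq_fun do rewrite /powR (gt_eqF (F0 _)).
have Dc : continuous (fun x => \det ((F x)^T *m F x)).
  by apply: continuous_det; apply: continuous_mulmx => //; exact: continuous_trmx.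
move=> x; apply: continuous_comp; last exact: continuous_expR.
apply: cvgM; first exact: cvg_cst.
apply: (@continuous_comp _ _ _ (fun x => \det ((F x)^T *m F x))); first exact: Dc.
exact: continuous_ln.
Qed.

Lemma compact_entry_le (m n : nat) (b : R) :
  compact [set M : 'M[R]_(m, n) | forall i j, `|M i j| <= b].
Proof.
have -> : [set M : 'M[R]_(m, n) | forall i j, `|M i j| <= b] =
    vec_mx @` [set v : 'rV[R]_(m * n) | forall k, `[-b, b]%classic (v ord0 k)].
  apply/seteqP; split => [M Mb|_ [v vb <-] i j].
    exists (mxvec M); last exact: mxvecK.
    by move=> k /=; case/mxvec_indexP: k => i j; rewrite mxvecE in_itv/= -ler_norml.
  by have := vb (mxvec_index i j); rewrite /= in_itv/= -ler_norml mxE.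
apply: continuous_compact; last first.
  apply: (@rV_compact _ _ (fun=> `[-b, b]%classic)) => _.
  exact: segment_compact.
apply: continuous_subspaceT; apply: continuous_mxP => i j.
under eq_fun do rewrite mxE.
by apply: continuous_entry => x; exact: cvg_id.
Qed.

(** If the form vanishes at [v], put [w = P v]: along [v + t w] it equals [2 t |w|^2 + t^2 q],
    negative for small negative [t] unless [w = 0]. Invertibility then gives [v = 0]. *)
Lemma psd_pos_def (n : nat) (P : 'M[R]_n) : P^T = P ->
  (forall v : 'cV[R]_n, 0 <= (v^T *m P *m v) ord0 ord0) -> P \in unitmx ->
  pos_def P.
Proof.
move=> Ps P0 PU v v0; rewrite lt_def P0 andbT; apply: contra_neq v0 => q0.
set w := P *m v; set s := (w^T *m w) ord0 ord0.
set q := (w^T *m P *m w) ord0 ord0.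
have qE t : ((v + t *: w)^T *m P *m (v + t *: w)) ord0 ord0 =
    2 * t * s + t ^+ 2 * q.
  have vPw : (v^T *m P *m w) ord0 ord0 = s.
    by rewrite /s /w trmx_mul Ps !mulmxA.
  have wPv : (w^T *m P *m v) ord0 ord0 = s by rewrite -mulmxA.
  have addE (M N : 'M[R]_1) : (M + N) ord0 ord0 = M ord0 ord0 + N ord0 ord0.
    by rewrite mxE.
  have scaleE a (M : 'M[R]_1) : (a *: M) ord0 ord0 = a * M ord0 ord0.
    by rewrite mxE.
  have -> : (v + t *: w)^T = v^T + t *: w^T by rewrite linearD linearZ.
  rewrite !(mulmxDl, mulmxDr).
  rewrite -!scalemxAl -!scalemxAr !(addE, scaleE) q0 vPw wPv -/q; ring.
have q_ge0 : 0 <= q by exact: P0.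
(* The denominator [q + 1] in place of the optimal [q] also covers [q = 0]. *)
have := P0 (v - (s / (q + 1)) *: w).
rewrite -scaleNr qE.
have -> : 2 * - (s / (q + 1)) * s + (- (s / (q + 1))) ^+ 2 * q =
    - (s ^+ 2 * (q + 2)) / (q + 1) ^+ 2.
  by field; rewrite gt_eqF// ltr_wpDl.
rewrite mulNr oppr_ge0 => le0.
have {le0} s2 : s ^+ 2 = 0.
  apply/eqP; apply: contraLR le0 => s2; rewrite -ltNge.
  have {}s2 : 0 < s ^+ 2 by rewrite lt_def s2 sqr_ge0.
  apply: divr_gt0; last by rewrite exprn_gt0// ltr_wpDl.
  by rewrite mulr_gt0// ltr_wpDl.
have /eqP w0 : w == 0 by rewrite -sqr_cV_eq0 -/s -sqrf_eq0 s2.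
by rewrite -(mulKmx PU v) -/w w0 mulmx0.
Qed.

(** Positive definiteness is not a closed condition, but at determinant 1 it can be replaced by
    semidefiniteness, which is. *)
Lemma closed_Conf (n : nat) : closed (@Conf R n).
Proof.
have idc : continuous (@id 'M[R]_n) by move=> P; exact: cvg_id.
have -> : @Conf R n =
    (\bigcap_(ij in [set: 'I_n * 'I_n])
      [set P : 'M[R]_n | P ij.1 ij.2 - P ij.2 ij.1 = 0]) `&`
    (\bigcap_(v in [set: 'cV[R]_n])
      [set P : 'M[R]_n | 0 <= (v^T *m P *m v) ord0 ord0]) `&`
    [set P : 'M[R]_n | \det P = 1].
  apply/seteqP; split => [P [Ps Pp Pd]|P [[Ps Pp] Pd]].
    split=> //; split=> [[i j] _ /=|v _ /=].
      by rewrite -[in X in _ - X]Ps mxE subrr.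
    have [->|v0] := eqVneq v 0; last exact/ltW/Pp.
    by rewrite mulmx0 mxE.
  have Ps' : P^T = P.
    by apply/matrixP => i j; rewrite mxE; apply/subr0_eq/(Ps (j, i)).
  split=> //; apply: psd_pos_def => // [v|]; first exact: Pp.
  by rewrite unitmxE Pd unitr1.
apply: closedI; [apply: closedI|].
- apply: closed_bigI => -[i j] _.
  apply: (@preimage_closed _ _ (fun P : 'M[R]_n => P i j - P j i) [set x | x = 0]).
    have cE k l : continuous (fun P : 'M[R]_n => P k l).
      exact: (continuous_entry idc).
    by move=> P _; exact: (cvgB (cE i j P) (cE j i P)).
  exact: closed_eq.
- apply: closed_bigI => v _.
  apply: (@preimage_closed _ _ (fun P : 'M[R]_n => (v^T *m P *m v) ord0 ord0)
    [set x | 0 <= x]); last exact: closed_ge.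
  move=> P _; apply: continuous_entry; do 2?apply: continuous_mulmx => //;
  exact: cst_continuous.
- apply: (@preimage_closed _ _ (fun P : 'M[R]_n => \det P) [set x | x = 1]).
    by move=> P _; exact: continuous_det.
  exact: closed_eq.
Qed.

Lemma compact_Conf_entry_le (n : nat) (b : R) :
  compact [set P : 'M[R]_n | Conf P /\ forall i j, `|P i j| <= b].
Proof.
have := compact_closedI (@compact_entry_le n n b) (@closed_Conf n).
by congr compact; apply/seteqP; split=> P [].
Qed.

End MatrixTopology.

(** * Operator norm bounds for the conformal action *)

Section Opnorm.
Variable R : realType.

Lemma euclid_norm_entry_le (n : nat) (v : 'cV[R]_n) (i : 'I_n) :
  `|v i ord0| <= euclid_norm v.
Proof.
rewrite -sqrtr_sqr ler_wsqrtr// (bigD1 i)//= lerDl.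
by apply: sumr_ge0 => j _; exact: sqr_ge0.
Qed.

Lemma entry_le_opnorm (n : nat) (M : 'M[R]_n) (i j : 'I_n) :
  `|M i j| <= opnorm M.
Proof.
pose v : 'cV[R]_n := delta_mx j ord0.
apply: (@le_trans _ _ (euclid_norm (M *m v))).
  by apply: le_trans (euclid_norm_entry_le _ i); rewrite -colE mxE.
apply: ub_le_sup.
  (* The [sup] dominates its set only once that set is known to be bounded; this bound comes from
     absolute row sums. *)
  exists (Num.sqrt (\sum_i (\sum_j `|M i j|) ^+ 2)) => _ [w /= w1 <-].
  rewrite ler_wsqrtr//; apply: ler_sum => k _.
  rewrite -[leLHS]real_normK ?num_real// lerXn2r ?nnegrE ?sumr_ge0//.
  rewrite mxE (le_trans (ler_norm_sum _ _ _))//; apply: ler_sum => l _.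
  by rewrite normrM ler_piMr// (le_trans (euclid_norm_entry_le _ _)).
exists v => //=; rewrite /euclid_norm (bigD1 j)//= big1 => [|k kj].
  by rewrite mxE !eqxx expr1n addr0 sqrtr1.
by rewrite mxE (negPf kj) expr0n.
Qed.

Lemma det_le_opnorm (n : nat) (M : 'M[R]_n) :
  `|\det M| <= n`!%:R * opnorm M ^+ n.
Proof.
rewrite (le_trans (ler_norm_sum _ _ _))//.
apply: (@le_trans _ _ (\sum_(s : 'S_n) opnorm M ^+ n)).
  apply: ler_sum => s _; rewrite normrM normr_sign mul1r normr_prod.
  have -> : opnorm M ^+ n = \prod_(i < n) opnorm M by rewrite prodr_const card_ord.
  apply: ler_prod => i _.
  by rewrite normr_ge0 entry_le_opnorm.
by rewrite sumr_const card_Sn mulr_natl.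
Qed.

(** The [n]-th power of the factor is [\det (invmx g) ^+ 2], bounded by expanding the determinant.
    Estimating [n!^2] by its own [n]-th power keeps roots out of the constant. *)
Lemma conf_scale_le_opnorm (n : nat) (g : 'M[R]_n) : (0 < n)%N ->
  g \in unitmx -> conf_scale g <= n`!%:R ^+ 2 * opnorm (invmx g) ^+ 2.
Proof.
move=> n0 gU; have g0 : \det g != 0 by rewrite -unitfE -unitmxE.
have b0 : 0 <= opnorm (invmx g).
  exact: le_trans (normr_ge0 _) (entry_le_opnorm _ (Ordinal n0) (Ordinal n0)).
have f1 : 1 <= (n`!%:R : R) by rewrite ler1n fact_gt0.
rewrite -(@ler_pXn2r _ n)// ?nnegrE ?(ltW (conf_scale_gt0 gU)) ?mulr_ge0 ?sqr_ge0//.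
have -> : conf_scale g ^+ n = \det (invmx g) ^+ 2.
  rewrite det_inv exprVn; apply: (mulIf (_ : \det g ^+ 2 != 0)).
    by rewrite sqrf_eq0.
  by rewrite conf_scale_expn// mulVf// sqrf_eq0.
rewrite -real_normK ?num_real//.
apply: (@le_trans _ _ ((n`!%:R * opnorm (invmx g) ^+ n) ^+ 2)).
  by rewrite lerXn2r ?nnegrE ?mulr_ge0 ?exprn_ge0// det_le_opnorm.
have -> : (n`!%:R * opnorm (invmx g) ^+ n) ^+ 2 =
    n`!%:R ^+ 2 * (opnorm (invmx g) ^+ 2) ^+ n by rewrite exprMn -!exprM mulnC.
rewrite [leRHS]exprMn ler_wpM2r ?exprn_ge0//.
by rewrite ler_eXnr// exprn_ege1.
Qed.

(** Keeps the orbit of the identity structure bounded. The scalar factor is at most quadratic in the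
    norm of [invmx g], and [g g^T] in that of [g], so the squared distortion appears. *)
Lemma conf_act1_entry_le (n : nat) (g : 'M[R]_n) (i j : 'I_n) (C : R) :
  g \in unitmx -> opnorm (invmx g) * opnorm g <= C ->
  `|conf_act g 1%:M i j| <= n`!%:R ^+ 2 * n%:R * C ^+ 2.
Proof.
move=> gU gC; have n0 : (0 < n)%N by case: (n) i => // -[].
have a0 : 0 <= opnorm g by exact: le_trans (normr_ge0 _) (entry_le_opnorm g i j).
have b0 : 0 <= opnorm (invmx g).
  by exact: le_trans (normr_ge0 _) (entry_le_opnorm _ i j).
have s0 := ltW (conf_scale_gt0 gU).
rewrite /conf_act -/(conf_scale g) mulmx1 mxE normrM (ger0_norm s0).
apply: (@le_trans _ _ (n`!%:R ^+ 2 * opnorm (invmx g) ^+ 2 * (n%:R * opnorm g ^+ 2))).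
  rewrite ler_pM// ?conf_scale_le_opnorm// mxE (le_trans (ler_norm_sum _ _ _))//.
  have -> : n%:R * opnorm g ^+ 2 = \sum_(k < n) opnorm g ^+ 2.
    by rewrite sumr_const card_ord mulr_natl.
  apply: ler_sum => k _.
  by rewrite normrM mxE expr2 ler_pM// entry_le_opnorm.
rewrite mulrACA -exprMn ler_wpM2l// ?mulr_ge0 ?exprn_ge0//.
by rewrite lerXn2r// nnegrE ?(le_trans _ gC) ?mulr_ge0.
Qed.

End Opnorm.

(** * Continuity of the Cholesky factor *)

Section ContinuousCholesky.
Variable R : realType.

Lemma continuous_block_mx (T : topologicalType) (m1 m2 n1 n2 : nat)
    (A : T -> 'M[R]_(m1, n1)) (B : T -> 'M[R]_(m1, n2))
    (C : T -> 'M[R]_(m2, n1)) (D : T -> 'M[R]_(m2, n2)) :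
  continuous A -> continuous B -> continuous C -> continuous D ->
  continuous (fun x => block_mx (A x) (B x) (C x) (D x)).
Proof.
move=> Ac Bc Cc Dc; apply: continuous_mxP => i j.
case: (split_ordP i) => k ->; case: (split_ordP j) => l ->.
- by under eq_fun do rewrite block_mxEul; exact: continuous_entry.
- by under eq_fun do rewrite block_mxEur; exact: continuous_entry.
- by under eq_fun do rewrite block_mxEdl; exact: continuous_entry.
- by under eq_fun do rewrite block_mxEdr; exact: continuous_entry.
Qed.

Lemma continuous_dlsubmx (T : topologicalType) (m1 m2 n1 n2 : nat)
    (F : T -> 'M[R]_(m1 + m2, n1 + n2)) :
  continuous F -> continuous (fun x => dlsubmx (F x)).
Proof.
move=> Fc; apply: continuous_mxP => i j; under eq_fun do rewrite !mxE.
exact: continuous_entry.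
Qed.

Lemma continuous_drsubmx (T : topologicalType) (m1 m2 n1 n2 : nat)
    (F : T -> 'M[R]_(m1 + m2, n1 + n2)) :
  continuous F -> continuous (fun x => drsubmx (F x)).
Proof.
move=> Fc; apply: continuous_mxP => i j; under eq_fun do rewrite !mxE.
exact: continuous_entry.
Qed.

Lemma continuous_inv (T : topologicalType) (f : T -> R) :
  (forall x, f x != 0) -> continuous f -> continuous (fun x => (f x)^-1).
Proof. by move=> f0 fc x; apply: cvgV; [exact: f0|exact: fc]. Qed.

Lemma continuous_cholesky (T : topologicalType) (n : nat) (P : T -> 'M[R]_n) :
  (forall x, (P x)^T = P x) -> (forall x, pos_def (P x)) -> continuous P ->
  continuous (fun x => cholesky (P x)).
Proof.
elim: n P => [//|m IH] P Ps Pp Pc.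
have P00 x : 0 < P x ord0 ord0 by exact: pos_def_diag.
have ac : continuous (fun x => P x ord0 ord0) := continuous_entry Pc.
have sc : continuous (fun x => Num.sqrt (P x ord0 ord0)).
  by move=> x; apply: continuous_comp; [exact: ac|exact: sqrt_continuous].
have bc : continuous (fun x => dlsubmx (P x : 'M[R]_(1 + m))).
  exact: (@continuous_dlsubmx _ 1 m 1 m).
apply: (@continuous_block_mx _ 1 m 1 m).
- apply: continuous_mxP => i j; rewrite (ord1 i) (ord1 j).
  under eq_fun do rewrite mxE mulr1n.
  exact: sc.
- exact: cst_continuous.
- apply: continuous_scalemx => //; apply: continuous_inv => // x.
  by rewrite gt_eqF// sqrtr_gt0.
- apply: IH.
  + move=> x; rewrite linearB linearZ/= trmx_mul trmxK; congr (_ - _).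
    by rewrite trmx_drsub Ps.
  + by move=> x; exact: pos_def_schur.
  + apply: continuous_addmx.
      exact: (@continuous_drsubmx _ 1 m 1 m).
    under eq_fun do rewrite -scaleNr.
    apply: continuous_scalemx.
      have ic : continuous (fun x => (P x ord0 ord0)^-1).
        by apply: continuous_inv => // x; rewrite gt_eqF.
      by move=> x; apply: cvgN; exact: ic.
    by apply: continuous_mulmx => //; exact: continuous_trmx.
Qed.

End ContinuousCholesky.

(** * The minimax centre of a compact invariant set *)

Section MinimaxCenter.
Variables (R : realType) (n : nat) (X : topologicalType) (G : Type).
Variables (act : G -> X -> X) (A : G -> X -> 'M[R]_n).
Variable Z : set (X * 'M[R]_n).
Hypothesis n_gt0 : (0 < n)%N.
Hypothesis X_hausdorff : hausdorff_space X.
Hypothesis act_minimal : minimal_action act.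
Hypothesis A_GL : forall f x, A f x \in unitmx.
Hypothesis Z_compact : compact Z.
Hypothesis Z_Conf : forall x Q, Z (x, Q) -> Conf Q.
Hypothesis Z_fiber : forall x, exists Q, Z (x, Q).
Hypothesis Z_invariant : forall f x Q,
  Z (x, Q) -> Z (act f x, conf_act (A f x) Q).

(** The strict inequality makes this an open condition on [x]; [cost_min] is the non-strict
    counterpart at the optimal level. *)
Definition cost_lt (x : X) (c : R) (P : 'M[R]_n) : Prop :=
  Conf P /\ forall Q, Z (x, Q) -> conf_cost P Q < c.

Let snd_continuous : continuous (fun z : X * 'M[R]_n => z.2).
Proof. by move=> z; exact: cvg_snd. Qed.

(** The points of [Z] with cost at least [c] form a compact set, whose projection to [X] is closed
    and misses [x]. This is the upper semicontinuity of the optimal level. *)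
Lemma cost_lt_near (x : X) (c : R) (P : 'M[R]_n) :
  cost_lt x c P -> \forall y \near x, cost_lt y c P.
Proof.
move=> [PC Pc]; pose S := Z `&` [set z | c <= conf_cost P z.2].
have S_compact : compact S.
  apply: compact_closedI => //.
  apply: (@preimage_closed _ _ (fun z : X * 'M[R]_n => conf_cost P z.2)
    [set t | c <= t]); last exact: closed_ge.
  move=> z _; apply: continuous_conf_cost; last exact: snd_continuous.
  exact: cst_continuous.
have : closed (fst @` S).
  apply: compact_closed => //; apply: continuous_compact => //.
  by apply: continuous_subspaceT => z; exact: cvg_fst.
move=> /closed_openC S_open; have : nbhs x (~` (fst @` S)).
  apply: open_nbhs_nbhs; split=> // -[[y Q] [/= xQ cQ] yx].
  by rewrite yx in xQ; have := Pc _ xQ; rewrite ltNge cQ.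
apply: filterS => y yS; split=> // Q yQ; rewrite ltNge; apply/negP => cQ.
by apply: yS; exists (y, Q).
Qed.

(** Every [Q] over [x] is carried into the fibre over [act f x] at equal cost, so competitors pull
    back. Pushing them forward would need the fibre map to be onto. *)
Lemma cost_lt_act (f : G) (x : X) (c : R) (P : 'M[R]_n) :
  cost_lt (act f x) c P -> cost_lt x c (conf_act (invmx (A f x)) P).
Proof.
move=> [PC Pc]; split; first by apply: conf_act_Conf; rewrite ?unitmx_inv.
move=> Q xQ; have QC := Z_Conf xQ.
rewrite -(conf_cost_act _ (A_GL f x) QC) conf_actKV//.
exact/Pc/Z_invariant.
Qed.

(** [P] remains a competitor near [x], minimality brings the orbit of [y] there, and the competitor
    is pulled back to [y]. Hence the same levels are attainable at every point. *)
Lemma cost_lt_transfer (x y : X) (c : R) (P : 'M[R]_n) :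
  cost_lt x c P -> exists P', cost_lt y c P'.
Proof.
move=> Pc; have : nbhs x [set z | cost_lt z c P] := cost_lt_near Pc.
rewrite nbhsE; case=> O [Oo Ox] OP.
have [|_ [/[swap] -[f _ <-] Of]] := act_minimal y _ Oo; first by exists x.
by exists (conf_act (invmx (A f y)) P); exact/cost_lt_act/OP.
Qed.

(** The infimum also ranges over base points; by [cost_lt_transfer] any single one would give the
    same value. *)
Definition minimax : R := inf [set c | exists x P, cost_lt x c P].

Lemma fiber_bounded (F : 'M[R]_n -> R) : continuous F ->
  exists c, forall x Q, Z (x, Q) -> F Q <= c.
Proof.
move=> Fc; have [Z0|/set0P Z0] := eqVneq Z set0; first by exists 0; rewrite Z0.
have [|c _ cmax] := @compact_EVT_max _ _ (fun z : X * 'M[R]_n => F z.2) Z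
  Z0 Z_compact.
  apply: continuous_subspaceT => z.
  by apply: continuous_comp; [exact: snd_continuous|exact: Fc].
by exists (F c.2) => x Q xQ; apply: (cmax (x, Q)); rewrite inE.
Qed.

Lemma cost_lt_ge (x : X) (c : R) (P : 'M[R]_n) : cost_lt x c P -> n%:R <= c.
Proof.
move=> [PC Pc]; have [Q xQ] := Z_fiber x.
exact: le_trans (conf_cost_ge PC (Z_Conf xQ)) (ltW (Pc _ xQ)).
Qed.

Lemma cost_lt_exists (x : X) : exists c P, cost_lt x c P.
Proof.
have [|c cP] := @fiber_bounded (conf_cost 1%:M).
  apply: continuous_conf_cost; first exact: cst_continuous.
  by move=> Q; exact: cvg_id.
exists (c + 1), 1%:M; split; first exact: Conf1.
by move=> Q /cP/le_lt_trans; apply; rewrite ltrDl.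
Qed.

Lemma minimax_le (x : X) (c : R) (P : 'M[R]_n) : cost_lt x c P -> minimax <= c.
Proof.
move=> Pc; apply: ge_inf; last by exists x, P.
by exists n%:R => c' [y [P' P'c]]; exact: cost_lt_ge P'c.
Qed.

Lemma minimax_lt (x : X) (c : R) : minimax < c -> exists P, cost_lt x c P.
Proof.
move=> /inf_lt[|c' [y [P Pc']] c'c].
  by have [c0 [P Pc]] := cost_lt_exists x; exists c0, x, P.
have [P' [P'C P'c]] := cost_lt_transfer x Pc'.
by exists P'; split=> // Q /P'c/lt_trans; apply.
Qed.

Lemma minimax_gt0 (x : X) : 0 < minimax.
Proof.
apply: (@lt_le_trans _ _ n%:R); first by rewrite ltr0n.
apply: lb_le_inf; first by have [c [P Pc]] := cost_lt_exists x; exists c, x, P.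
by move=> c [y [P Pc]]; exact: cost_lt_ge Pc.
Qed.

(** Any [Q] in the fibre serves in [conf_trace_le]; traces over the compact [Z] have a common bound,
    which makes [b] uniform in [x]. *)
Lemma cost_lt_entry_le (c : R) : exists b : R, forall x P i j,
  cost_lt x c P -> `|P i j| <= b.
Proof.
have [|t tP] := @fiber_bounded mxtrace.
  by apply: continuous_mxtrace => Q; exact: cvg_id.
exists (n%:R ^+ 2 * (c * t)) => x P i j [PC Pc]; have [Q xQ] := Z_fiber x.
have QC := Z_Conf xQ; have [[Ps Pp _] [_ Qp _]] := (PC, QC).
apply: le_trans (pos_def_entry_le i j Ps Pp) _.
apply: le_trans (conf_trace_le PC QC) _; rewrite ler_wpM2l ?exprn_ge0//.
apply: ler_pM; last exact: tP xQ.
- exact: le_trans (ler0n _ _) (conf_cost_ge PC QC).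
- exact: mxtrace_pos_def.
- exact/ltW/Pc.
Qed.

Definition cost_min (x : X) (P : 'M[R]_n) : Prop :=
  Conf P /\ forall Q, Z (x, Q) -> conf_cost P Q <= minimax.

Lemma cost_min_lt (x : X) (c : R) (P : 'M[R]_n) :
  minimax < c -> cost_min x P -> cost_lt x c P.
Proof. by move=> rc [PC Pr]; split=> // Q /Pr/le_lt_trans; apply. Qed.

(** Competitors with excess [1/(k+1)] stay in a compact set. Each constraint is closed in the
    competitor, so a cluster point satisfies them all at level [minimax]. *)
Lemma cost_min_exists (x : X) : exists P, cost_min x P.
Proof.
pose e (k : nat) : R := k.+1%:R^-1.
have e0 k : 0 < e k by rewrite invr_gt0.
have /choice[P_ P_lt] : forall k, exists P, cost_lt x (minimax + e k) P.
  by move=> k; apply: minimax_lt; rewrite ltrDl.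
have [b bP] := cost_lt_entry_le (minimax + 1).
have Pb k i j : `|P_ k i j| <= b.
  apply: (bP x); have [PC Pc] := P_lt k; split=> // Q /Pc/lt_le_trans; apply.
  by rewrite lerD2l invf_le1// ler1n.
have [|P [[PC _] Pcl]] := @compact_Conf_entry_le R n b (P_ @ \oo) _.
  by exists 0%N => // k _; split; [have [] := P_lt k|exact: Pb].
exists P; split=> // Q xQ; apply/ler_addgt0Pr => d d0.
have DP : closed [set P' | conf_cost P' Q <= minimax + d].
  apply: (@preimage_closed _ _ (fun P' => conf_cost P' Q) [set t | t <= minimax + d]).
    move=> z _; apply: continuous_conf_cost; last exact: cst_continuous.
    by move=> Q'; exact: cvg_id.
  exact: closed_le.
apply: DP => U PU.
have FD : \forall k \near \oo, conf_cost (P_ k) Q <= minimax + d.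
  near=> k; have [_ /(_ _ xQ)/ltW/le_trans] := P_lt k; apply.
  rewrite lerD2l ltW//; near: k; exact: (near_infty_natSinv_lt (PosNum d0)).
have [z []] := Pcl [set P' | conf_cost P' Q <= minimax + d] U FD PU.
by exists z.
Unshelve. all: by end_near. Qed.

(* The midpoint, rescaled to determinant [1], competes in the minimax. *)
Lemma det_midpoint_le (x : X) (c : R) (P P' : 'M[R]_n) :
  cost_lt x c P -> cost_lt x c P' ->
  minimax ^+ n * \det (2^-1 *: (P + P')) <= c ^+ n.
Proof.
move=> Pc P'c; have [Ms Mp] := Conf_midpoint Pc.1 P'c.1.
set M := _ *: _ in Ms Mp *.
have d0 : 0 < \det M := det_pos_def Ms Mp.
pose t := \det M `^ (- n%:R^-1).
have t0 : 0 < t by rewrite powR_gt0.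
have td : t ^+ n * \det M = 1.
  rewrite -powR_mulrn ?powR_ge0// /t -powRrM mulNr mulVf ?pnatr_eq0 -?lt0n//.
  by rewrite powR_inv1 ?mulVf// ?gt_eqF ?ltW.
have /minimax_le rtc : cost_lt x (t * c) (t *: M).
  split.
    split; [by rewrite linearZ/= Ms| |by rewrite detZ].
    by move=> v v0; rewrite -scalemxAr -scalemxAl mxE mulr_gt0// Mp.
  move=> Q xQ; rewrite !conf_costZ conf_costD ltr_pM2l//.
  by have := Pc.2 _ xQ; have := P'c.2 _ xQ; lra.
have r0 := ltW (minimax_gt0 x).
have : minimax ^+ n <= (t * c) ^+ n.
  by rewrite lerXn2r// nnegrE// (le_trans r0).
by rewrite -(ler_pM2r d0) exprMn mulrAC td mul1r.
Qed.

(** Turns a midpoint determinant [d] above 1 into a level that contradicts [det_midpoint_le]: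
    [minimax] times the [n]-th root of the mean of 1 and [d]. *)
Lemma minimax_gap (x : X) (d : R) : 1 < d ->
  exists2 c, minimax < c & c ^+ n < minimax ^+ n * d.
Proof.
move=> d1; have r0 := minimax_gt0 x; pose d' := (1 + d) / 2.
have d'1 : 1 < d' by rewrite /d'; lra.
have d'0 : 0 <= d' by rewrite ltW// (lt_trans _ d'1).
have dn : (d' `^ n%:R^-1) ^+ n = d'.
  rewrite -powR_mulrn ?powR_ge0// -powRrM mulVf ?powRr1//.
  by rewrite pnatr_eq0 -lt0n.
exists (minimax * d' `^ n%:R^-1).
  rewrite ltr_pMr// ltNge; apply/negP => le1; move: d'1; rewrite -dn ltNge.
  by rewrite exprn_ile1 ?powR_ge0.
by rewrite exprMn dn ltr_pM2l ?exprn_gt0// /d'; lra.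
Qed.

Lemma cost_min_unique (x : X) (P P' : 'M[R]_n) :
  cost_min x P -> cost_min x P' -> P = P'.
Proof.
move=> Pm P'm; apply/eqP/negPn/negP => /(det_midpoint_gt1 Pm.1 P'm.1).
move=> /(minimax_gap x)[c rc]; apply/negP; rewrite -leNgt.
by apply: (@det_midpoint_le x); exact: cost_min_lt.
Qed.

(** The pullback preserves optimality because [minimax] is the optimal level both at [x] and at
    [act f x]. *)
Lemma cost_min_act (f : G) (x : X) (P : 'M[R]_n) :
  cost_min (act f x) P -> cost_min x (conf_act (invmx (A f x)) P).
Proof.
move=> [PC Pc]; split; first by apply: conf_act_Conf; rewrite ?unitmx_inv.
move=> Q xQ; have QC := Z_Conf xQ.
rewrite -(conf_cost_act _ (A_GL f x) QC) conf_actKV//.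
exact/Pc/Z_invariant.
Qed.

(* The fibres of [Z] are only upper semicontinuous. The missing half comes from
   [minimax] being the same over all points: for [y] near [x] both [phi x] and
   [phi y] are almost optimal at [y], so their midpoint has determinant close
   to [1]. *)
Lemma cost_min_continuous (phi : X -> 'M[R]_n) :
  (forall x, cost_min x (phi x)) -> continuous phi.
Proof.
move=> phim x U; rewrite nbhsE; case=> O [Oo Ox] OU.
have [b bP] := cost_lt_entry_le (minimax + 1).
have phib y i j : `|phi y i j| <= b.
  by apply: (bP y); apply: cost_min_lt => //; rewrite ltrDl.
(* Candidates outside the neighbourhood [O]. If there are any, the determinant of the midpoint with
   [phi x] has a minimum over this compact set; it exceeds 1, so a single level [c] excludes them
   all. *)
pose F := [set P : 'M[R]_n | Conf P /\ forall i j, `|P i j| <= b] `&` ~` O.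
have F_compact : compact F.
  apply: compact_closedI; first exact: compact_Conf_entry_le.
  exact: open_closedC.
suff [c rc cF] : exists2 c, minimax < c &
    forall P, F P -> c ^+ n < minimax ^+ n * \det (2^-1 *: (phi x + P)).
  have := cost_lt_near (cost_min_lt rc (phim x)); apply: filterS => y yc.
  apply: OU; apply: contrapT => yO; have := cF (phi y).
  rewrite ltNge (det_midpoint_le yc (cost_min_lt rc (phim y))) => yF.
  have // : false by apply: yF; split=> //; split=> //; have [] := phim y.
have [F0|/set0P F0] := eqVneq F set0.
  by exists (minimax + 1) => [|P]; rewrite ?ltrDl// F0.
have [|P PF Pmin] := @compact_EVT_min _ _
    (fun P : 'M[R]_n => \det (2^-1 *: (phi x + P))) F F0 F_compact.
  apply: continuous_subspaceT; apply: continuous_det; apply: continuous_scalemx.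
    exact: cst_continuous.
  by apply: continuous_addmx; [exact: cst_continuous|move=> P; exact: cvg_id].
rewrite inE in PF; have [[PC _] PO] := PF.
have [|c rc cP] := @minimax_gap x (\det (2^-1 *: (phi x + P))).
  apply: det_midpoint_gt1 => //; first by have [] := phim x.
  by apply/eqP => xP; apply: PO; rewrite -xP.
exists c => // P' P'F; apply: lt_le_trans cP _.
rewrite ler_pM2l ?exprn_gt0 ?(minimax_gt0 x)//.
by apply: Pmin; rewrite inE.
Qed.

Lemma invariant_conformal_structure_exists :
  exists phi, continuous_invariant_conformal_structure act A phi.
Proof.
have /choice[phi phim] := cost_min_exists.
exists phi; split=> [|x|f x]; first exact: cost_min_continuous.
  by have [] := phim x.
have := cost_min_unique (cost_min_act (phim (act f x))) (phim x).
by move=> <-; rewrite conf_actKV.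
Qed.

End MinimaxCenter.

(** * Straightening the cocycle, and the closure of the skew orbit *)

Lemma mx_size0 (R : realType) (n : nat) (M N : 'M[R]_n) : n = 0%N -> M = N.
Proof.
by move=> n0; apply/matrixP => -[i i_lt]; exfalso; move: i_lt; rewrite n0.
Qed.

Lemma closure_sub_closed (T : topologicalType) (E D : set T) :
  closed D -> E `<=` D -> closure E `<=` D.
Proof. by move=> cD ED; rewrite (closure_id D).1//; exact: closureS. Qed.

Lemma conformal_of_mul_tr (R : realType) (n : nat) (M : 'M[R]_n) (s : R) :
  0 < s -> M *m M^T = s%:M -> conformal M.
Proof.
move=> s0 MM; have c0 : 0 < Num.sqrt s by rewrite sqrtr_gt0.
exists (Num.sqrt s), ((Num.sqrt s)^-1 *: M); split=> //; last first.
  by rewrite scalerA mulfV ?scale1r// gt_eqF.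
(* [orthogonal_mx] concerns [U^T U], while the hypothesis controls [U U^T]. *)
apply: mulmx1C; rewrite linearZ/= -scalemxAl -scalemxAr scalerA MM.
by rewrite -invfM -expr2 sqr_sqrtr ?ltW// scale_scalar_mx mulVf// gt_eqF.
Qed.

(** Take [B] with [B B^T = phi]. By invariance [A phi A^T] at [x] is a positive multiple of [phi] at
    [act f x], so the straightened matrix times its transpose is scalar. *)
Lemma conformal_coboundary (R : realType) (n : nat) (X : topologicalType)
    (G : Type) (act : G -> X -> X) (A : G -> X -> 'M[R]_n) (phi : X -> 'M[R]_n) :
  (forall f x, A f x \in unitmx) ->
  continuous_invariant_conformal_structure act A phi ->
  exists B : X -> 'M[R]_n,
    [/\ continuous B, forall x, B x \in unitmx &
        forall f x, conformal (invmx (B (act f x)) *m A f x *m B x)].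
Proof.
move=> AU [phic phiC phi_inv].
have Bspec x : cholesky (phi x) *m (cholesky (phi x))^T = phi x.
  by have [Ps Pp _] := phiC x; have [] := cholesky_spec Ps Pp.
have BU x : cholesky (phi x) \in unitmx.
  by have [Ps Pp _] := phiC x; exact: cholesky_unit.
exists (fun x => cholesky (phi x)); split=> [|x|f x]; last 1 first.
- have s0 := conf_scale_gt0 (AU f x); set s := conf_scale (A f x) in s0.
  move: (Bspec (act f x)) (BU (act f x)); rewrite phi_inv.
  move: (cholesky (conf_act _ _)) => C CC CU.
  apply: (@conformal_of_mul_tr _ _ _ s^-1); first by rewrite invr_gt0.
  rewrite !trmx_mul !mulmxA -[_ *m cholesky _ *m _]mulmxA Bspec.
  have E : A f x *m phi x *m (A f x)^T = s^-1 *: (C *m C^T).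
    by rewrite CC /conf_act -/(conf_scale _) -/s scalerA mulVf ?scale1r ?gt_eqF.
  rewrite -!mulmxA [A f x *m (_ *m _)]mulmxA.
  rewrite [_ *m ((A f x)^T *m _)]mulmxA E -scalemxAl -scalemxAr.
  rewrite -[C *m C^T *m _]mulmxA mulKmx// -trmx_mul mulVmx// trmx1.
  by rewrite scalemx1.
- by apply: continuous_cholesky => // x; have [] := phiC x.
- exact: BU.
Qed.

Theorem theoremB (R : realType) (n : nat) (X : metricType R)
    (G : semigroupType) (act : G -> X -> X) (A : G -> X -> 'M[R]_n)
    (X_compact : compact [set: X])
    (act_homeo : forall f : G, homeomorphism (act f))
    (act_mul : forall (f g : G) (x : X), act (f * g)%g x = act f (act g x))
    (act_minimal : minimal_action act)
    (A_GL : forall (f : G) (x : X), A f x \in unitmx)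
    (A_continuous : forall f : G, continuous (A f))
    (A_cocycle : forall (f g : G) (x : X),
       A (f * g)%g x = A f (act g x) *m A g x)
    (A_bounded : exists (x0 : X) (C : R),
       0 < C /\ forall f : G, distortion A f x0 <= C) :
  (exists phi : X -> 'M[R]_n,
     continuous_invariant_conformal_structure act A phi) /\
  (exists B : X -> 'M[R]_n,
     [/\ continuous B,
         forall x : X, B x \in unitmx &
         forall (f : G) (x : X),
           conformal (invmx (B (act f x)) *m A f x *m B x)]).
Proof.
suff [phi phiP] : exists phi, continuous_invariant_conformal_structure act A phi.
  by split; [exists phi|exact: conformal_coboundary phiP].
(* The minimax argument takes [n]-th roots; for [n = 0] all matrices coincide. *)
have [n0|n_gt0] := posnP n.
  exists (fun=> 1%:M); split=> [|x|f x]; first exact: cst_continuous.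
    exact: Conf1.
  exact: mx_size0.
have [x0 [C [_ distC]]] := A_bounded.
pose point (f : G) := (act f x0, conf_act (A f x0) 1%:M).
pose b : R := n`!%:R ^+ 2 * n%:R * C ^+ 2.
pose K := [set P : 'M[R]_n | Conf P /\ forall i j, `|P i j| <= b].
have K_compact : compact K := @compact_Conf_entry_le R n b.
have K_closed : closed K.
  by apply: compact_closed => //; exact: norm_hausdorff.
(* As [G] need not have a unit, [(x0, 1)] itself may lie outside [Z]; only its images are
   collected. *)
pose Z := closure (range point).
have ZK : Z `<=` [set: X] `*` K.
  apply: closure_sub_closed.
    have snd_c : continuous (fun z : X * 'M[R]_n => z.2).
      by move=> z; exact: cvg_snd.
    have -> : [set: X] `*` K = (fun z : X * 'M[R]_n => z.2) @^-1` K.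
      by apply/seteqP; split=> [z []|z].
    by apply: preimage_closed => // z _; exact: snd_c.
  move=> _ [f _ <-]; split=> //; split=> [|i j /=].
    by apply: conf_act_Conf; [exact: A_GL|exact: Conf1].
  exact/conf_act1_entry_le/distC.
have Z_compact : compact Z.
  apply: subclosed_compact ZK; first exact: closed_closure.
  exact: compact_setX.
have proj_closed : closed (fst @` Z).
  apply: compact_closed; first exact: metric_hausdorff.
  apply: continuous_compact => //; apply: continuous_subspaceT => z.
  exact: cvg_fst.
apply: (@invariant_conformal_structure_exists R n X G act A Z) => //.
- exact: metric_hausdorff.
- by move=> x Q /ZK[_ []].
(* The projection of [Z] is closed and contains the dense orbit of [x0], so it is all of [X]. *)
- move=> x; suff [[y Q] xQ <-] : (fst @` Z) x by exists Q.
  apply: contrapT => xZ.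
  have [|_ [/[swap] -[f _ <-]]] := act_minimal x0 _ _ (closed_openC proj_closed).
    by exists x.
  by apply; exists (point f) => //; apply: subset_closure; exists f.
(* By the cocycle identity the skew map [F] sends [point g] to [point (f * g)]; being continuous, it
   also maps the closure into itself. *)
- move=> f x Q; pose F (z : X * 'M[R]_n) := (act f z.1, conf_act (A f z.1) z.2).
  suff ZF : Z `<=` F @^-1` Z by move=> xQ; exact: (ZF (x, Q)).
  apply: closure_sub_closed => [|_ [g _ <-]].
    apply: preimage_closed; last exact: closed_closure.
    have [act_c _] := act_homeo f.
    have fst_c : continuous (fun z : X * 'M[R]_n => z.1).
      by move=> z; exact: cvg_fst.
    have snd_c : continuous (fun z : X * 'M[R]_n => z.2).
      by move=> z; exact: cvg_snd.
    have act_fst_c : continuous (fun z : X * 'M[R]_n => act f z.1).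
      by move=> z; apply: continuous_comp; [exact: fst_c|exact: act_c].
    have A_fst_c : continuous (fun z : X * 'M[R]_n => A f z.1).
      by move=> z; apply: continuous_comp; [exact: fst_c|exact: A_continuous].
    have conf_c := continuous_conf_act (fun z => A_GL f z.1) A_fst_c snd_c.
    by move=> z _; exact: cvg_pair (act_fst_c z) (conf_c z).
  apply: subset_closure; exists (f * g)%g => //.
  by rewrite /F /point /= act_mul A_cocycle conf_actM.
Qed.
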